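(* For every $k \geq 1$, the closure $\overline{A_{k}} = \{p \in \beta\mathbb{N} : A_{k} \in p\}$ of the set $A_{k} = E_{0}^{(k)} + \cdots + E_{k-1}^{(k)}$ meets $\Sigma_{k}$ but not $\Sigma_{k+1}$; that is, $\overline{A_{k}} \cap \Sigma_{k} \neq \emptyset$ and $\overline{A_{k}} \cap \Sigma_{k+1} = \emptyset$.
   Context: $\mathbb{N} = \{1,2,3,\dots\}$ is discrete; $\beta\mathbb{N}$ is the space of ultrafilters on $\mathbb{N}$, with basis of clopen sets $\overline{A} = \{p \in \beta\mathbb{N} : A \in p\}$ for $A \subseteq \mathbb{N}$; each $n\in\mathbb{N}$ is identified with the principal ultrafilter at $n$, and $\mathbb{N}^{*} = \beta\mathbb{N} \setminus \mathbb{N}$ is the set of free (non-principal) ultrafilters. Addition on $\beta\mathbb{N}$ is defined by $A \in p + q \iff \{n \in \mathbb{N} : -n + A \in q\} \in p$, where $-n + A = \{m \in \mathbb{N} : n + m \in A\}$; it is associative, and for each fixed $q$ the map $p \mapsto p+q$ is continuous. The cumulative depth filtration is defined by $\Sigma_{0} = \beta\mathbb{N}$, $\Sigma_{1} = \mathbb{N}^{*}$, and $\Sigma_{k+1} = \overline{\mathbb{N}^{*} + \Sigma_{k}}$ for $k \geq 1$, where $\mathbb{N}^{*} + \Sigma_{k} = \{r + v : r \in \mathbb{N}^{*}, v \in \Sigma_{k}\}$ and the closure is taken in $\beta\mathbb{N}$. Let $e_{n} = 2^{2^{n}}$ for $n \geq 1$. For $k \geq 1$ and $t \in \{0, \dots,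 k-1\}$, $E_{t}^{(k)} = \{ e_{n} : n \geq 1,\ n \equiv t \pmod k \}$, and $A_k = E_{0}^{(k)} + \cdots + E_{k-1}^{(k)} = \{x_0 + \cdots + x_{k-1} : x_t \in E_t^{(k)}\}$ is the sumset. *)

(* Defs.v *)
From HB Require Import structures.
From mathcomp Require Import all_boot.
From mathcomp Require Import all_classical topology_structure.

Set Implicit Arguments.
Unset Strict Implicit.
Unset Printing Implicit Defensive.

Local Open Scope classical_set_scope.

Definition posint : Type := {n : nat | (0 < n)%N}.

Lemma addp_subproof (m n : posint) : (0 < val m + val n)%N.
Proof. by rewrite addn_gt0 (valP m). Qed.

Definition addp (m n : posint) : posint :=
  exist (fun n => 0 < n)%N (val m + val n)%N (addp_subproof m n).

Record betaN : Type := BetaN {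
  ultra_sets :> set posint -> Prop;
  ultra_setsP : UltraFilter ultra_sets }.

#[global] Existing Instance ultra_setsP.

HB.instance Definition _ := gen_eqMixin betaN.
HB.instance Definition _ := gen_choiceMixin betaN.

Definition basic_clopen (A : set posint) : set betaN := [set p : betaN | p A].

Lemma basic_clopen_cover :
  \bigcup_(A in [set: set posint]) basic_clopen A = setT.
Proof. by apply/seteqP; split=> // p _; exists setT => //; exact: filterT. Qed.

Lemma basic_clopen_join (A B : set posint) (p : betaN) :
  [set: set posint] A -> [set: set posint] B ->
  basic_clopen A p -> basic_clopen B p ->
  exists C, [/\ [set: set posint] C, basic_clopen C p
    & basic_clopen C `<=` basic_clopen A `&` basic_clopen B].
Proof.
move=> _ _ pA pB; exists (A `&` B); split=> //; first exact: filterI.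
by move=> q qAB; split; apply: filterS qAB => x [].
Qed.

HB.instance Definition _ :=
  isBaseTopological.Build betaN basic_clopen_cover basic_clopen_join.

Definition principal (n : posint) : betaN := BetaN (principal_filter_ultra n).

(* With this identification of posint with a subset of betaN, the basic clopen
   sets are the topological closures of the subsets of posint. *)
Lemma closure_principal (A : set posint) :
  closure (principal @` A) = basic_clopen A.
Proof.
apply/seteqP; split=> p.
- move=> clp; case: (in_ultra_setVsetC A (ultra_setsP p)) => // pnA.
  have : nbhs p (basic_clopen (~` A)).
    apply: open_nbhs_nbhs; split=> //.
    exists [set ~` A] => //.
    by rewrite bigcup_set1.
  by move=> /clp [q [[n An <-] /principal_filterP]].
- move=> pA U; rewrite nbhsE => -[O [[D _ <-] [B DB pB]] OU].
  have [n [An Bn]] : (A `&` B) !=set0.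
    by apply: (@filter_ex _ (ultra_sets p)); exact: filterI.
  exists (principal n); split; first by exists n.
  by apply: OU; exists B => //; exact/principal_filterP.
Qed.

(* -n + A *)
Definition shift (n : posint) (A : set posint) : set posint :=
  [set m | A (addp n m)].

Definition sum_sets (p q : betaN) : set_system posint :=
  [set A | p [set n | q (shift n A)]].

Lemma sum_sets_ultra (p q : betaN) : UltraFilter (sum_sets p q).
Proof.
have FF : Filter (sum_sets p q).
  split.
  - by apply: filterS (@filterT _ (ultra_sets p) _) => n _; exact: filterT.
  - move=> A B pA pB; apply: (@filterS _ (ultra_sets p) _ _ _ _
      (filterI (F := ultra_sets p) pA pB)) => n [qA qB].
    exact: filterI qA qB.
  - move=> A B AB; apply: (@filterS _ (ultra_sets p)) => n /=.
    apply: filterS => m; exact: AB.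
split.
  apply: Build_ProperFilter_ex => A pA.
  have [n qA] := filter_ex (F := ultra_sets p) pA.
  have [m Am] := filter_ex (F := ultra_sets q) qA.
  by exists (addp n m).
move=> G GF sG; apply/seteqP; split; last exact: sG.
move=> A GA; have [//|pnA] := in_ultra_setVsetC [set n | q (shift n A)]
  (ultra_setsP p).
have /sG GnA : sum_sets p q (~` A).
  apply: filterS pnA => n nqA.
  by have [/nqA|] := in_ultra_setVsetC (shift n A) (ultra_setsP q).
by have [x []] := filter_ex (filterI GA GnA).
Qed.

Definition addbeta (p q : betaN) : betaN := BetaN (sum_sets_ultra p q).

Definition Nstar : set betaN := ~` range principal.

Fixpoint Sigma (k : nat) : set betaN :=
  match k with
  | 0 => setT
  | 1 => Nstar
  | j.+1 => closure [set addbeta r v | r in Nstar & v in Sigma j]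
  end.

Lemma e_subproof (n : posint) : (0 < 2 ^ (2 ^ val n))%N.
Proof. by rewrite expn_gt0. Qed.

Definition e (n : posint) : posint :=
  exist (fun m => 0 < m)%N (2 ^ (2 ^ val n))%N (e_subproof n).

Definition E (k t : nat) : set posint :=
  [set e n | n in [set n : posint | val n = t %[mod k]]].

(* The equation is taken in nat, since posint has no neutral element for an
   iterated sum. *)
Definition sumset (k : nat) : set posint :=
  [set a | exists x : 'I_k -> posint,
     (forall t : 'I_k, E k t (x t)) /\ val a = (\sum_(t < k) val (x t))%N].

(* Main.v *)
(** If [p = r + w] contains a translate of the m-fold sumset of the numbers
    2^2^i and [r] is free, then [w] contains the intersection of two such
    translates, by [-n] and [-n'] with [d = n' - n > 0].  A point of it gives
    two m-term sums differing by [d]; since [d < 2^2^d], their difference is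
    not divisible by 2^2^d, so a summand 2^2^i with [i < d] occurs in one of
    them.  Removing it leaves finitely many translates of the (m-1)-fold
    sumset, one of which belongs to [w]: each free left summand costs a term.
    Conversely, a sum of free ultrafilters on [E k 0], ..., [E k (k-1)] lies in
    [Sigma k] and contains [sumset k]. *)
Require Import Defs.
From mathcomp Require Import all_boot all_classical topology_structure.
From mathcomp Require Import zify.

Local Open Scope classical_set_scope.

Lemma ultraI {p : betaN} {A B : set posint} : p A -> p B -> p (A `&` B).
Proof. exact: filterI. Qed.

Lemma ultra_nonempty {p : betaN} {A : set posint} : p A -> A !=set0.
Proof. exact: filter_ex. Qed.

Lemma ultra_not_setC {p : betaN} {A : set posint} : ~ p A -> p (~` A).
Proof. by case: (in_ultra_setVsetC A (ultra_setsP p)). Qed.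

Lemma ultra_bigcup_ord {p : betaN} {d : nat} {F : 'I_d -> set posint} :
  p [set x | exists i, F i x] -> exists i, p (F i).
Proof.
move=> pF; apply: contrapT => nF.
have pC : p [set x | forall i, (~` F i) x].
  apply: (filter_forall (F := ultra_sets p)) => i.
  by apply: ultra_not_setC => pFi; apply: nF; exists i.
by have [x [[i Fx] /(_ i)]] := filter_ex (ultraI pF pC).
Qed.

Lemma Nstar_setC1 {p : betaN} (n : posint) : Nstar p -> p (~` [set n]).
Proof.
move=> pfree; apply: ultra_not_setC => pn; apply: pfree; exists n => //.
(* Containing [[set n]] puts the whole principal ultrafilter inside [p]; maximality turns this
   inclusion into equality. *)
have sub A : principal_filter n A -> p A.
  by move=> /principal_filterP An; apply: filterS pn => x ->.
have eqp : ultra_sets p = principal_filter n.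
  exact: (@max_filter _ _ (principal_filter_ultra n) _ _ sub).
case: p {pn sub} eqp => P UP /= eqp; subst P.
by rewrite /principal; congr BetaN; exact: Prop_irrelevance.
Qed.

(** The basic clopen set of [A] is a neighbourhood of [p], so it meets the set of sums before
    closure; the sum [r + w] found there need not be [p]. *)
Lemma Sigma_succ {m : nat} {p : betaN} {A : set posint} :
  Sigma m.+2 p -> p A ->
  exists r w, [/\ Nstar r, Sigma m.+1 w & r [set n | w (shift n A)]].
Proof.
move=> clp pA; have : nbhs p (basic_clopen A).
  by apply: open_nbhs_nbhs; split=> //; exists [set A]; rewrite ?bigcup_set1.
by move=> /clp [q [[r rfree [w wS <-]] rwA]]; exists r, w.
Qed.

(* The translate b - a of the m-fold sumset, with a moved to the left so that
   no subtraction occurs. *)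
Definition translate (a b m : nat) : set posint :=
  [set x | exists l : seq nat,
     size l = m /\ (val x + a = b + \sum_(i <- l) 2 ^ (2 ^ i))%N].

Lemma sum_tower_small {l l' : seq nat} {d : nat} : (0 < d)%N ->
  (\sum_(i <- l') 2 ^ (2 ^ i) = d + \sum_(i <- l) 2 ^ (2 ^ i))%N ->
  exists2 i, (i < d)%N & i \in l ++ l'.
Proof.
move=> d0 eqd; apply: contrapT => nsmall.
(* If every index were at least [d], then [2 ^ (2 ^ d)] would divide both sums, hence [d]. *)
have dvd s : {subset s <= l ++ l'} ->
    (2 ^ (2 ^ d) %| \sum_(i <- s) 2 ^ (2 ^ i))%N.
  move=> ss; rewrite big_seq; apply: dvdn_sum => i /ss ill.
  rewrite dvdn_exp2l // leq_exp2l // leqNgt.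
  by apply/negP => id; apply: nsmall; exists i.
have : (2 ^ (2 ^ d) %| d)%N.
  rewrite -(@dvdn_addl (\sum_(i <- l) 2 ^ (2 ^ i))%N).
    by rewrite -eqd dvd // => i il; rewrite mem_cat il orbT.
  by rewrite dvd // => i il; rewrite mem_cat il.
move/(dvdn_leq d0); rewrite leqNgt => /negP; apply.
have lt_expl n : (n < 2 ^ n)%N by exact: ltn_expl.
exact: ltn_trans (lt_expl d) (lt_expl (2 ^ d)%N).
Qed.

Lemma translate_rem {a b m i : nat} {x : posint} {l : seq nat} :
  i \in l -> size l = m.+1 -> (val x + a = b + \sum_(j <- l) 2 ^ (2 ^ j))%N ->
  translate a (b + 2 ^ (2 ^ i)) m x.
Proof.
move=> il sl eqx; exists (rem i l); split; first by rewrite size_rem // sl.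
by rewrite eqx (big_rem i il) /= addnA.
Qed.

Lemma translate_setI {a a' b m : nat} {x : posint} : (a < a')%N ->
  translate a b m.+1 x -> translate a' b m.+1 x ->
  exists i : 'I_(a' - a), translate a (b + 2 ^ (2 ^ i)) m x \/
                          translate a' (b + 2 ^ (2 ^ i)) m x.
Proof.
move=> aa' [l [sl eql]] [l' [sl' eql']].
have [||i id] := @sum_tower_small l l' (a' - a); [by rewrite subn_gt0 | lia |].
rewrite mem_cat => /orP[il|il]; exists (Ordinal id).
  by left; exact: translate_rem il sl eql.
by right; exact: translate_rem il sl' eql'.
Qed.

Lemma Sigma_translate {m : nat} {p : betaN} {a b : nat} :
  Sigma m.+1 p -> ~ p (translate a b m).
Proof.
(* Both offsets stay general: a shift changes [a], and removing a summand changes [b]. *)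
elim: m p a b => [p a b pfree pT|m IHm p a b pS pT].
  (* A translate of the empty sum has at most one point, which a free ultrafilter avoids. *)
  have [y [l [/size0nil-> eqy]]] := ultra_nonempty pT.
  have [x [[l' [/size0nil-> eqx]] /= xy]] :=
    filter_ex (ultraI pT (Nstar_setC1 y pfree)).
  by apply: xy; apply: val_inj; move: eqx eqy; rewrite !big_nil; lia.
have [r [w [rfree wS rwT]]] := Sigma_succ pS pT.
have [n wn] := ultra_nonempty rwT.
have [n' [wn' /= nn']] :=
  filter_ex (ultraI rwT (Nstar_setC1 n rfree)).
have shiftT (k : posint) :
    w (shift k (translate a b m.+1)) -> w (translate (val k + a) b m.+1).
  apply: filterS => x [l [sl eqx]]; exists l; split=> //.
  by rewrite -eqx /= addnCA addnA.
have both c c' : (c < c')%N ->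
    w (translate c b m.+1) -> w (translate c' b m.+1) -> False.
  move=> cc' wc wc'.
  (* The ultrafilter [w] selects one [i] of this finite union, while by induction it contains
     neither translate for that [i]. *)
  have /ultra_bigcup_ord[i wi] : w [set x | exists i : 'I_(c' - c),
      (translate c (b + 2 ^ (2 ^ i)) m `|` translate c' (b + 2 ^ (2 ^ i)) m) x].
    apply: filterS (ultraI wc wc') => x [].
    exact: translate_setI.
  have wCi := ultraI
    (ultra_not_setC (IHm w c (b + 2 ^ (2 ^ i))%N wS))
    (ultra_not_setC (IHm w c' (b + 2 ^ (2 ^ i))%N wS)).
  by have [x [[xT|xT] []]] :=
    ultra_nonempty (ultraI wi wCi).
have : val n != val n' by apply/eqP => /val_inj /esym.
rewrite neq_ltn => /orP[lt|lt].
  by apply: both (shiftT _ wn) (shiftT _ wn'); rewrite ltn_add2r.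
by apply: both (shiftT _ wn') (shiftT _ wn); rewrite ltn_add2r.
Qed.

Lemma sumset_translate (k : nat) : sumset k `<=` translate 0 0 k.
Proof.
move=> a [x [xE eqa]].
have /choice[n nE] : forall t : 'I_k, exists n : nat, val (x t) = (2 ^ 2 ^ n)%N.
  by move=> t; have [n _ <-] := xE t; exists (val n).
exists [seq n t | t <- enum 'I_k]; split; first by rewrite size_map size_enum_ord.
rewrite addn0 add0n eqa big_map big_enum /=.
by apply: eq_bigr => t _; exact: nE.
Qed.

Lemma Nstar_E {k : nat} (t : nat) : (0 < k)%N -> exists2 p : betaN, Nstar p & p (E k t).
Proof.
move=> k0.
(* Using [j.+1] keeps the index positive even when [t = 0]. *)
have idx_gt0 j : (0 < t + k * j.+1)%N by rewrite addn_gt0 muln_gt0 k0 orbT.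
pose idx j : posint := exist (fun n => 0 < n)%N _ (idx_gt0 j).
pose f j := e (idx j).
have [G [UG sG]] := @ultraFilterLemma _ (f @ \oo) _.
exists (BetaN UG) => /=; last first.
  apply: sG; exists 0 => // j _; exists (idx j) => //=.
  by rewrite addnC mulnC modnMDl.
move=> [n _ /(congr1 ultra_sets)/= eqG].
have : G (~` [set n]).
  (* For [j >= n], the value [f j] exceeds its index, which is at least [j + 1 > n]; so this tail of
     [f] misses [n]. *)
  apply: sG; exists (val n) => // j /= nj eqn.
  have /(congr1 val)/= := eqn; have lt1 := ltn_expl (t + k * j.+1) (isT : (1 < 2)%N).
  have := ltn_expl (2 ^ (t + k * j.+1)) (isT : (1 < 2)%N).
  have : (j.+1 <= k * j.+1)%N by rewrite leq_pmull.
  by move: nj lt1; lia.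
by rewrite -eqG => /principal_filterP; apply.
Qed.

(** The family [F] is arbitrary so that the induction can split off [F 0] as the left summand and
    pass to the shifted family. *)
Lemma Sigma_sumset (m : nat) {F : nat -> set posint} :
  (forall t, exists2 p : betaN, Nstar p & p (F t)) ->
  exists2 p : betaN, Sigma m.+1 p &
    p [set a | exists x : nat -> posint,
         (forall t, (t <= m)%N -> F t (x t)) /\
         val a = (\sum_(t < m.+1) val (x t))%N].
Proof.
elim: m F => [|m IHm] F freeF; have [p pfree pF] := freeF 0.
  exists p => //; apply: filterS pF => n Fn; exists (fun=> n).
  by split=> [t|]; [rewrite leqn0 => /eqP-> | rewrite big_ord1].
have [q qS qF] := IHm (fun t => F t.+1) (fun t => freeF t.+1).
exists (addbeta p q); first by apply: subset_closure; exists p => //; exists q.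
apply: filterS pF => n Fn; apply: filterS qF => a [x [xF eqa]].
exists (fun t => if t is t'.+1 then x t' else n); split; first by case=> //.
by rewrite big_ord_recl /= eqa.
Qed.

Theorem mainTheorem3 (k : nat) (hk : (1 <= k)%N) :
  (basic_clopen (sumset k) `&` Sigma k !=set0) /\
  (basic_clopen (sumset k) `&` Sigma k.+1 = set0).
Proof.
split.
  case: k hk => // k hk.
  have [p pS pF] := Sigma_sumset k (fun t => Nstar_E t hk).
  exists p; split=> //; apply: filterS pF => a [x [xE eqa]].
  by exists (fun t => x t); split=> // t; apply: xE; rewrite -ltnS.
apply/seteqP; split=> // p [pA /Sigma_translate]; apply.
exact: filterS (@sumset_translate k) pA.
Qed.
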